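(* Let $f \in L^2(\mathbb{R})$ be an ultimately positive function and let $\Lambda=\{(\tau_k,\omega_k)\}_{k=0}^N\subset\mathbb{R}^2$ be such that the affine dimension of $\Omega=\{\omega_0,\dotsc,\omega_N\}$ over $\mathbb{Q}$ is at least $N-1$. Then the Gabor system $\mathcal{G}(f,\Lambda)$ is linearly independent.
   Context: For $\tau,\omega\in\mathbb{R}$ and $f:\mathbb{R}\to\mathbb{C}$, the time and frequency shifts are $T_\tau f(t)=f(t-\tau)$ and $M_\omega f(t)=e^{2\pi i\omega t}f(t)$. For a finite set $\Lambda\subset\mathbb{R}^2$, the Gabor system generated by $f$ and $\Lambda$ is $\mathcal{G}(f,\Lambda)=\{M_\omega T_\tau f:(\tau,\omega)\in\Lambda\}$, regarded as a family indexed by the (distinct) points of $\Lambda$. It is linearly independent if the only complex coefficients $(c_{(\tau,\omega)})_{(\tau,\omega)\in\Lambda}$ with $\sum_{(\tau,\omega)\in\Lambda}c_{(\tau,\omega)}M_\omega T_\tau f=0$ almost everywhere are all zero. A function $f:\mathbb{R}\to\mathbb{C}$ is called ultimately positive if there is some $t_0\in\mathbb{R}$ such that $f(t)>0$ (in particular $f(t)$ is real) for all $t\ge t_0$. For a finite set $\Omega\subset\mathbb{R}$, the affine dimension of $\Omega$ over $\mathbb{Q}$ is the dimension of the $\mathbb{Q}$-vector space spanned by $\Omega-\omega=\{\omega'-\omega:\omega'\in\Omega\}$, where $\omega\in\Omega$; it does not depend on the choice of $\omega\in\Omega$. Here $\Lambda$ is a set of $N+1$ points, while the $\omega_k$ need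 not be pairwise distinct. *)

(* Defs.v *)
From HB Require Import structures.
From mathcomp Require Import all_boot all_order all_algebra.
From mathcomp Require Import all_classical all_reals all_analysis.
From mathcomp Require Import complex.

Set Implicit Arguments.
Unset Strict Implicit.
Unset Printing Implicit Defensive.

Import Order.TTheory GRing.Theory Num.Theory.
Import numFieldNormedType.Exports.

Local Open Scope classical_set_scope.
Local Open Scope ring_scope.
Local Open Scope complex_scope.

Definition translation (R : realType) (tau : R) (f : R -> R[i]) : R -> R[i] :=
  fun t => f (t - tau).

(* e^(2 pi i omega t) is spelled cos (2 pi omega t) + i sin (2 pi omega t). *)
Definition modulation (R : realType) (omega : R) (f : R -> R[i]) : R -> R[i] :=
  fun t => (cos (2 * pi * omega * t) +i* sin (2 * pi * omega * t)) * f t.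

(* A finite subset of R^2 is given by an enumeration, whose injectivity is to
   be assumed separately; the system is then indexed by the points. *)
Definition gabor (R : realType) (I : finType) (f : R -> R[i])
    (Lambda : I -> R * R) : I -> R -> R[i] :=
  fun k => modulation (Lambda k).2 (translation (Lambda k).1 f).

Definition lin_indep_ae (R : realType) (I : finType) (g : I -> R -> R[i]) :
    Prop :=
  forall c : I -> R[i],
    {ae @lebesgue_measure R, forall t, \sum_(k : I) c k * g k t = 0} ->
    forall k, c k = 0.

(* measurable_fun refers to the Borel sets, so a function represents an element
   of L^2(R) when it is a.e. equal to a square-integrable Borel function; every
   square-integrable Lebesgue-measurable function is covered. *)
Definition in_L2 (R : realType) (f : R -> R[i]) : Prop :=
  exists g : R -> R[i],
    [/\ measurable_fun [set: R] (fun t : R => complex.Re (g t)),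
        measurable_fun [set: R] (fun t : R => complex.Im (g t)),
        (\int[@lebesgue_measure R]_t (ComplexField.Normc.normc (g t) ^+ 2)%:E
           < +oo)%E
      & {ae @lebesgue_measure R, forall t, f t = g t}].

(* In the order of R[i], 0 < z means that z is real and positive. *)
Definition ultimately_positive (R : realType) (f : R -> R[i]) : Prop :=
  exists t0 : R, forall t : R, t0 <= t -> 0 < f t.

Definition freeQ (R : realType) (n : nat) (b : 'I_n -> R) : Prop :=
  forall q : 'I_n -> rat,
    \sum_(i < n) ratr (q i) * b i = 0 -> forall i, q i = 0.

Definition spanQ (R : realType) (A : set R) : set R :=
  [set x | exists (n : nat) (q : 'I_n -> rat) (a : 'I_n -> R),
     (forall i, A (a i)) /\ x = \sum_(i < n) ratr (q i) * a i].

Definition is_dimQ (R : realType) (V : set R) (d : nat) : Prop :=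
  exists b : 'I_d -> R, freeQ b /\ spanQ (range b) = V.

(* The base point is immaterial. *)
Definition is_affine_dimQ (R : realType) (Omega : set R) (d : nat) : Prop :=
  exists2 w : R, Omega w & is_dimQ (spanQ [set w' - w | w' in Omega]) d.

(* Main.v *)
Require Import Defs.
From HB Require Import structures.
From mathcomp Require Import all_boot all_order all_algebra.
From mathcomp Require Import all_classical all_reals all_analysis.
From mathcomp Require Import measurable_realfun complex.
From mathcomp Require Import ring lra zify.

Set Implicit Arguments.
Unset Strict Implicit.
Unset Printing Implicit Defensive.

Import Order.TTheory GRing.Theory Num.Theory.
Import numFieldNormedType.Exports.
Import ComplexField.Normc.

Local Open Scope classical_set_scope.
Local Open Scope ring_scope.
Local Open Scope complex_scope.

(** Suppose that the combination of the M_(w k) T_(tau k) f with coefficients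
    c k vanishes almost everywhere.  Where t is large, every f (t - tau k) is
    positive, so the relation says that a positive combination of the complex
    numbers c k * exp(2 i pi (w k) t) is zero.  This is impossible if, at one
    such t, those of these numbers that are not zero lie in an open half-plane:
    by continuity the same holds on a neighbourhood of t, which has positive
    measure.

    Kronecker's theorem ([kronecker], [kronecker_affine]) tells which phases
    the numbers exp(2 i pi (w k) t) approach, up to a common rotation, for
    arbitrarily large t: all those that satisfy, modulo full turns, every
    integer relation a with sum a = 0 and sum (a k)(w k) = 0.  It is proved
    here by averaging along an arithmetic progression the m-th power of the
    nonnegative trigonometric polynomial
    prod_k (2 + 2 cos (2 pi (x k * t - th k))), and letting m grow.

    The hypothesis on the affine dimension makes the group of integer relations
    cyclic ([affine_relation_generator]); let a be a generator.  The phases of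
    the c k can then be compensated up to errors smaller than a quarter turn,
    unless a is the difference of two unit vectors e_p - e_q and c p, c q have
    opposite phases ([phase_correction]).  In this exceptional case w p = w q.
    Turning both terms p and q onto the imaginary axis while all other terms
    are sent to the right half-plane shows that c k = 0 for k other than p and
    q ([phase_selection]).  What remains is a two-term relation
    c p * f (t - tau p) + c q * f (t - tau q) = 0 with tau p different from
    tau q.  It makes |f|^2 nondecreasing along some nontrivial arithmetic
    progression, which a function of L^2 that is not almost everywhere zero
    cannot be ([two_term_relation]). *)

(** * The complex exponential *)

(** The unit complex number exp(2 i pi x). *)
Definition cexp (R : realType) (x : R) : R[i] :=
  cos (2 * pi * x) +i* sin (2 * pi * x).

Lemma cexpD (R : realType) (x y : R) : cexp (x + y) = cexp x * cexp y.
Proof.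
rewrite /cexp mulrDr cosD sinD; apply/eqP; rewrite eq_complex /=.
by rewrite [X in _ && (_ == X)]addrC !eqxx.
Qed.

Lemma cexp0 (R : realType) : cexp (0 : R) = 1.
Proof. by rewrite /cexp mulr0 cos0 sin0. Qed.

Lemma cexp_sum (R : realType) (I : finType) (F : I -> R) :
  cexp (\sum_i F i) = \prod_i cexp (F i).
Proof. by rewrite (big_morph (@cexp R) (@cexpD R) (cexp0 R)). Qed.

Lemma cexpMn (R : realType) (x : R) (n : nat) : cexp (x *+ n) = cexp x ^+ n.
Proof.
elim: n => [|n IHn]; first by rewrite mulr0n cexp0.
by rewrite mulrS cexpD IHn exprS.
Qed.

Lemma cexpNM (R : realType) (x : R) : cexp (- x) * cexp x = 1.
Proof. by rewrite -cexpD addNr cexp0. Qed.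

Lemma cexp_int (R : realType) (z : int) : cexp (z%:~R : R) = 1.
Proof.
have e1 : cexp (1 : R) = 1.
  by rewrite /cexp mulr1 mulrC mulr_natr cos2pi sin2pi.
have en (n : nat) : cexp (n%:R : R) = 1 by rewrite cexpMn e1 expr1n.
case: (intP z) => [|n|n]; first by rewrite cexp0.
  exact: en n.+1.
by rewrite mulrNz -[RHS](cexpNM (n.+1%:R)) en mulr1.
Qed.

Lemma normc_cexp (R : realType) (x : R) : normc (cexp x) = 1.
Proof. by rewrite /cexp /= cos2Dsin2 sqrtr1. Qed.

Lemma normc_ge0 (R : realType) (z : R[i]) : 0 <= normc z.
Proof. by case: z => a b; exact: sqrtr_ge0. Qed.

Lemma normc_gt0 (R : realType) (z : R[i]) : z != 0 -> 0 < normc z.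
Proof.
move=> zn0; rewrite lt_neqAle normc_ge0 andbT eq_sym.
by apply: contra zn0 => /eqP/eq0_normc/eqP.
Qed.

Lemma cexp_neq1 (R : realType) (x : R) : x != 0 -> `|x| < 1 -> cexp x != 1.
Proof.
move=> x0 x1; apply/negP => /eqP [cos1 _].
have xgt0 : 0 < `|x| by rewrite normr_gt0.
have : 0 < sin (pi * `|x|).
  by apply: sin_gt0_pi; rewrite mulr_gt0 ?pi_gt0//= gtr_pMr ?pi_gt0.
suff -> : sin (pi * `|x|) = 0 by rewrite ltxx.
have cos1' : cos ((pi * `|x|) *+ 2) = 1.
  rewrite -mulr_natl mulrA; case: (ger0P x) => _; first exact: cos1.
  by rewrite mulrN cosN; exact: cos1.
move: cos1'; rewrite cos_mulr2n cos2sin2 => h.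
apply/eqP; rewrite -sqrf_eq0; apply/eqP; lra.
Qed.

Lemma Re_sum (R : realType) (I : finType) (P : pred I) (F : I -> R[i]) :
  complex.Re (\sum_(i | P i) F i) = \sum_(i | P i) complex.Re (F i).
Proof. by apply: (big_morph (@complex.Re R)) => // -[a b] [c d]. Qed.

Lemma Re_realM (R : realType) (a : R) (z : R[i]) :
  complex.Re (a%:C * z) = a * complex.Re z.
Proof. by case: z => x y /=; rewrite mul0r subr0. Qed.

Lemma norm_Re_le (R : realType) (z : R[i]) : `|complex.Re z| <= normc z.
Proof.
case: z => a b /=; rewrite -[X in X <= _]sqrtr_sqr.
by rewrite ler_wsqrtr// lerDl sqr_ge0.
Qed.

Lemma normc_geometric_le (R : realType) (z : R[i]) (M : nat) :
  normc z = 1 -> z != 1 ->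
  normc (\sum_(n < M) z ^+ n) <= 2 / normc (z - 1).
Proof.
move=> z1 zn1.
have nz : 0 < normc (z - 1) by rewrite normc_gt0// subr_eq0.
rewrite ler_pdivlMr// mulrC -normcM -subrX1.
have zM : normc (z ^+ M) = 1.
  elim: M => [|M IHM]; first by rewrite expr0 normc1.
  by rewrite exprS normcM z1 IHM mulr1.
apply: le_trans (le_normcD _ _) _.
by rewrite normcN zM normc1.
Qed.

Lemma le_of_muln_le (R : realType) (a b C : R) :
  (forall M : nat, M%:R * a <= M%:R * b + C) -> a <= b.
Proof.
move=> H; rewrite leNgt; apply/negP => ba.
have d0 : 0 < a - b by rewrite subr_gt0.
have := Num.Theory.archi_boundP (normr_ge0 (C / (a - b))).
set M := Num.bound _; rewrite normrM [X in _ * X]gtr0_norm ?invr_gt0//.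
rewrite ltr_pdivrMr// => h.
have := H M; have := ler_norm C; nra.
Qed.

(** * Averages of trigonometric polynomials *)

(** The terms of frequency zero being constants coef i, their sum is the mean
    value of the trigonometric polynomial, so any upper bound of the real part
    that is valid on a half-line bounds this sum. *)
Lemma trig_mean_le (R : realType) (I : finType) (coef lam mu : I -> R)
    (T U : R) :
  (forall i, 0 <= coef i) ->
  (forall i, lam i = 0 -> cexp (- mu i) = 1) ->
  (forall t, T <= t ->
    complex.Re (\sum_i (coef i)%:C * cexp (lam i * t - mu i)) <= U) ->
  \sum_(i | lam i == 0) coef i <= U.
Proof.
move=> coef0 mu0 KU.
pose S := 1 + \sum_i `|lam i|.
have S0 : 0 < S by rewrite ltr_pwDl// sumr_ge0.
(* The step h is so small that exp(2 i pi (lam i) h) = 1 only when lam i = 0: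
   the other frequencies contribute bounded geometric sums. *)
pose h := S^-1.
have lamh i : `|lam i * h| < 1.
  rewrite normrM [`|h|]gtr0_norm ?invr_gt0// ltr_pdivrMr// mul1r /S.
  by rewrite (bigD1 i)//= addrCA ltrDl ltr_pwDl// sumr_ge0.
pose C := \sum_(i | lam i != 0) coef i * (2 / normc (cexp (lam i * h) - 1)).
apply: (@le_of_muln_le _ _ _ C) => M.
rewrite -lerBlDr.
apply: (@le_trans _ _ (\sum_(n < M) complex.Re
    (\sum_i (coef i)%:C * cexp (lam i * (T + h *+ n) - mu i)))); last first.
  rewrite mulr_natl -[X in _ *+ X]card_ord -sumr_const ler_sum// => n _.
  by rewrite KU// lerDl mulrn_wge0// invr_ge0 ltW.
rewrite -Re_sum exchange_big Re_sum.
rewrite [leRHS](bigID (fun i => lam i == 0)) /=.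
rewrite lerD//.
  rewrite mulr_sumr ler_sum// => i /eqP li.
  rewrite -mulr_sumr Re_realM mulrC ler_wpM2l//.
  under eq_bigr => n _ do rewrite li mul0r sub0r mu0//.
  by rewrite Re_sum /= sumr_const card_ord.
rewrite -sumrN ler_sum// => i li.
rewrite -mulr_sumr Re_realM -mulrN ler_wpM2l//.
rewrite lerNl (le_trans (ler_norm _))// normrN (le_trans (norm_Re_le _))//.
have -> : \sum_(n < M) cexp (lam i * (T + h *+ n) - mu i) =
    cexp (lam i * T - mu i) * \sum_(n < M) cexp (lam i * h) ^+ n.
  rewrite mulr_sumr; apply: eq_bigr => n _.
  by rewrite -cexpMn -cexpD mulrDr mulrnAr addrAC.
rewrite normcM normc_cexp mul1r normc_geometric_le ?normc_cexp// cexp_neq1//.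
by rewrite mulf_neq0// invr_neq0// gt_eqF.
Qed.

Lemma sqr_sum_le (R : realFieldType) (I : finType) (c : I -> R) :
  (\sum_i c i) ^+ 2 <= #|I|%:R * \sum_i c i ^+ 2.
Proof.
have : 0 <= \sum_i \sum_j (c i - c j) ^+ 2.
  by rewrite sumr_ge0// => i _; rewrite sumr_ge0// => j _; rewrite sqr_ge0.
have -> : \sum_i \sum_j (c i - c j) ^+ 2 =
    2 * (#|I|%:R * \sum_i c i ^+ 2) - 2 * (\sum_i c i) ^+ 2.
  transitivity (\sum_i (#|I|%:R * c i ^+ 2 + \sum_j c j ^+ 2
                        - 2 * (c i * \sum_j c j))).
    apply: eq_bigr => i _.
    rewrite mulr_natl -sumr_const !mulr_sumr -big_split -sumrB /=.
    by apply: eq_bigr => j _; ring.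
  rewrite sumrB big_split /= -!mulr_sumr -mulr_suml sumr_const.
  by rewrite -[_ *+ #|I|]mulr_natl; ring.
lra.
Qed.

Lemma poly_expn_lt1 (R : realType) (n : nat) (v : R) : 0 < v <= 1 ->
  exists m : nat, m.+1%:R ^+ n * (1 - v) ^+ m < 1.
Proof.
move=> /andP[v0 v1].
pose B := 2 ^+ n * n.+1`!%:R / v ^+ n.+1.
have := Num.Theory.archi_boundP (normr_ge0 B).
set m := Num.bound _; rewrite ger0_norm; last first.
  by rewrite !mulr_ge0 ?invr_ge0 ?exprn_ge0// ltW.
move=> hm; exists m.
have m0 : (0 < m)%N.
  rewrite lt0n; apply/eqP => m0; move: hm; rewrite m0 ltNge => /negP; apply.
  by rewrite !mulr_ge0 ?invr_ge0 ?exprn_ge0// ltW.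
have mR : 0 < m%:R :> R by rewrite ltr0n.
have h1 : (1 - v) ^+ m <= expR (- (v * m%:R)).
  rewrite -mulNr expRM_natr lerXn2r ?nnegrE ?expR_ge0 ?subr_ge0//.
  exact: expR_ge1Dx.
have h2 : m.+1%:R ^+ n < expR (v * m%:R).
  apply: lt_le_trans (expR_ge1Dxn n _); last by rewrite mulr_ge0// ltW.
  apply: (@le_lt_trans _ _ (2 ^+ n * m%:R ^+ n)).
    rewrite -exprMn lerXn2r ?nnegrE ?mulr_ge0//.
    by rewrite -natrM ler_nat mul2n -addnn -addn1 leq_add2l.
  apply: (@lt_le_trans _ _ ((v * m%:R) ^+ n.+1 / n.+1`!%:R)); last first.
    by rewrite lerDr.
  rewrite ltr_pdivlMr ?ltr0n ?fact_gt0// exprMn [m%:R ^+ n.+1]exprS.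
  move: hm; rewrite /B ltr_pdivrMr ?exprn_gt0// => hm.
  by rewrite mulrAC mulrA [v ^+ _ * _]mulrC ltr_pM2r ?exprn_gt0.
apply: (@le_lt_trans _ _ (m.+1%:R ^+ n * expR (- (v * m%:R)))).
  by rewrite ler_wpM2l// exprn_ge0.
by rewrite expRN ltr_pdivrMr ?expR_gt0// mul1r.
Qed.

Lemma prod_real_complex (R : realType) (I : finType) (F : I -> R) :
  (\prod_i F i)%:C = \prod_i (F i)%:C.
Proof.
apply: (big_morph (fun z : R => z%:C)) => // x y.
exact: (rmorphM (real_complex R)).
Qed.

Lemma cexp_factor (R : realType) (m : nat) (y : R) :
  (1 + cexp y) ^+ m * (1 + cexp (- y)) ^+ m =
    ((2 + 2 * cos (2 * pi * y)) ^+ m)%:C.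
Proof.
rewrite -exprMn rmorphXn /=; congr (_ ^+ _).
rewrite mulrDl mul1r mulrDr mulr1 [cexp y * _]mulrC cexpNM /cexp.
rewrite mulrN cosN sinN.
apply/eqP; rewrite eq_complex /=; apply/andP; split; apply/eqP; ring.
Qed.

(** The coefficient of the monomial of exponent F in prod_k (1 + X_k) ^ m. *)
Definition multibin (R : realType) (n m : nat)
    (F : {ffun 'I_n -> 'I_m.+1}) : R :=
  \prod_k 'C(m, F k)%:R.

Lemma multibin_ge0 (R : realType) (n m : nat) (F : {ffun 'I_n -> 'I_m.+1}) :
  0 <= multibin R F.
Proof. exact: prodr_ge0. Qed.

Lemma sum_multibin (R : realType) (n m : nat) :
  \sum_(F : {ffun 'I_n -> 'I_m.+1}) multibin R F = 2 ^+ (m * n).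
Proof.
rewrite /multibin.
rewrite -(bigA_distr_bigA (fun (_ : 'I_n) (i : 'I_m.+1) => 'C(m, i)%:R : R)).
rewrite prodr_const card_ord exprM; congr (_ ^+ _).
have := exprDn (1 : R) 1 m; rewrite -natr1 => ->.
by apply: eq_bigr => i _; rewrite !expr1n mulr1.
Qed.

Lemma prod_cexp_expand (R : realType) (n m : nat) (y : 'I_n -> R) :
  \prod_k (1 + cexp (y k)) ^+ m =
  \sum_(F : {ffun 'I_n -> 'I_m.+1})
     (multibin R F)%:C * cexp (\sum_k (F k)%:R * y k).
Proof.
rewrite /multibin.
under eq_bigr => k _.
  rewrite exprDn.
  under eq_bigr => i _ do
    rewrite expr1n mul1r -cexpMn -mulr_natl -[y k *+ _]mulr_natl.
  over.
rewrite bigA_distr_bigA /=; apply: eq_bigr => F _.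
rewrite big_split /= cexp_sum prod_real_complex; congr (_ * _).
by under [RHS]eq_bigr => k _ do rewrite rmorph_nat.
Qed.

(** The kernel of the averaging argument as a trigonometric polynomial with
    nonnegative coefficients. *)
Lemma kernel_expand (R : realType) (n m : nat) (y : 'I_n -> R) :
  (\prod_k (2 + 2 * cos (2 * pi * y k)) ^+ m)%:C =
  \sum_(G : {ffun 'I_n -> 'I_m.+1} * {ffun 'I_n -> 'I_m.+1})
    (multibin R G.1 * multibin R G.2)%:C *
      cexp (\sum_k ((G.1 k)%:Z - (G.2 k)%:Z)%:~R * y k).
Proof.
rewrite prod_real_complex.
under eq_bigr => k _ do rewrite -cexp_factor.
rewrite big_split /= !prod_cexp_expand big_distrlr /= pair_big /=.
apply: eq_bigr => -[F H] _ /=.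
rewrite mulrACA -rmorphM -cexpD; congr (_ * cexp _).
rewrite -big_split /=; apply: eq_bigr => k _.
by rewrite intrB !pmulrn; ring.
Qed.

(** * Kronecker's theorem *)

(** If every integer relation between the frequencies x also holds between the
    phases th modulo 1, then all the x k * t - th k are simultaneously close to
    integers for arbitrarily large t. *)
Lemma kronecker (R : realType) (n : nat) (x th : 'I_n -> R) (T delta : R) :
  (forall a : 'I_n -> int, \sum_k (a k)%:~R * x k = 0 ->
     cexp (\sum_k (a k)%:~R * th k) = 1) ->
  0 < delta <= 1 ->
  exists2 t, T <= t &
    forall k, 1 - delta < cos (2 * pi * (x k * t - th k)).
Proof.
move=> rel /andP[d0 d1]; apply: contrapT => /forall2NP H.
have {}H t : T <= t -> exists k, cos (2 * pi * (x k * t - th k)) <= 1 - delta.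
  by move=> Tt; case: (H t) => // /existsNP[k /negP]; rewrite -leNgt; exists k.
(* The kernel prod_k (2 + 2 cos (2 pi (x k * t - th k))) ^ m has mean value at
   least 4 ^ (m * n) / (m + 1) ^ n, but if the conclusion fails it is at most
   4 ^ (m * n) * (1 - delta / 2) ^ m; these are incompatible for large m. *)
have [m hm] := @poly_expn_lt1 R n (delta / 2) ltac:(apply/andP; split; lra).
pose I := ({ffun 'I_n -> 'I_m.+1} * {ffun 'I_n -> 'I_m.+1})%type.
pose coef (G : I) : R := multibin R G.1 * multibin R G.2.
pose b (G : I) k : int := (G.1 k)%:Z - (G.2 k)%:Z.
pose lam (G : I) := \sum_k (b G k)%:~R * x k.
pose mu (G : I) := \sum_k (b G k)%:~R * th k.
have coef0 G : 0 <= coef G by rewrite mulr_ge0// multibin_ge0.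
pose U : R := 4 ^+ (m * n) * (1 - delta / 2) ^+ m.
have := @trig_mean_le R I coef lam mu T U coef0.
have mu0 G : lam G = 0 -> cexp (- mu G) = 1.
  by move=> /rel eG; rewrite -[RHS](cexpNM (mu G)) [cexp (mu G)]eG mulr1.
move=> /(_ mu0).
have KU t : T <= t ->
    complex.Re (\sum_G (coef G)%:C * cexp (lam G * t - mu G)) <= U.
  move=> Tt.
  have -> : \sum_G (coef G)%:C * cexp (lam G * t - mu G) =
     (\prod_k (2 + 2 * cos (2 * pi * (x k * t - th k))) ^+ m)%:C.
    rewrite kernel_expand; apply: eq_bigr => G _; congr (_ * cexp _).
    rewrite /lam /mu mulr_suml -sumrB; apply: eq_bigr => k _.
    by rewrite mulrBr mulrA.
  rewrite /= /U.
  have [k hk] := H t Tt.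
  have n0 : n = n.-1.+1 by case: (n) k {hk} => // -[].
  have cosm (y : R) : 0 <= 2 + 2 * cos (2 * pi * y) <= 4.
    have := cos_le1 (2 * pi * y); have := cos_geN1 (2 * pi * y).
    by move=> ? ?; apply/andP; split; lra.
  have -> : 4 ^+ (m * n) = 4 ^+ m * 4 ^+ (m * n.-1) :> R.
    by rewrite -exprD -mulnS -n0.
  rewrite (bigD1 k) //= [leRHS]mulrAC -exprMn.
  apply: ler_pM.
  - by rewrite exprn_ge0//; case/andP: (cosm (x k * t - th k)).
  - apply: prodr_ge0 => j _; apply: exprn_ge0.
    by case/andP: (cosm (x j * t - th j)).
  - apply: lerXn2r; rewrite ?nnegrE; last by lra.
      by case/andP: (cosm (x k * t - th k)).
    by rewrite mulr_ge0// subr_ge0; lra.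
  rewrite exprM.
  have -> : (4 ^+ m : R) ^+ n.-1 = \prod_(j | j != k) (4 ^+ m).
    by rewrite prodr_const cardC1 card_ord.
  apply: ler_prod => j _; have /andP[c0 c4] := cosm (x j * t - th j).
  by rewrite exprn_ge0//= lerXn2r ?nnegrE.
move=> /(_ KU); apply/negP; rewrite -ltNge.
apply: (@lt_le_trans _ _ (\sum_(F : {ffun 'I_n -> 'I_m.+1}) multibin R F ^+ 2)).
  have := sqr_sum_le (@multibin R n m).
  rewrite sum_multibin card_ffun !card_ord natrX -exprM mulnC exprM.
  have -> : 2 ^+ 2 = 4 :> R by rewrite -natrX.
  move=> cs.
  have m0 : 0 < m.+1%:R ^+ n :> R by rewrite exprn_gt0.
  rewrite -(ltr_pM2l m0); apply: lt_le_trans cs.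
  by rewrite /U mulrCA gtr_pMr// exprn_gt0.
(* Only the diagonal pairs (F, F), which have frequency zero, are kept. *)
rewrite [leRHS]big_mkcond /=.
rewrite -(pair_bigA _
  (fun F H => if lam (F, H) == 0 then coef (F, H) else 0)) /=.
apply: ler_sum => F _; rewrite (bigD1 F)//= /lam /b /=.
rewrite big1; last by move=> k _; rewrite subrr mul0r.
by rewrite eqxx expr2 lerDl; apply: sumr_ge0 => G _; case: ifP.
Qed.

(** Only the relations with coefficients of sum zero matter when all phases are
    measured relatively to the one of index j. *)
Lemma kronecker_affine (R : realType) (n : nat) (w th : 'I_n -> R) (j : 'I_n)
    (T delta : R) :
  (forall a : 'I_n -> int, \sum_k a k = 0 -> \sum_k (a k)%:~R * w k = 0 ->
     cexp (\sum_k (a k)%:~R * th k) = 1) ->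
  0 < delta <= 1 ->
  exists2 t, T <= t &
    forall k, 1 - delta < cos (2 * pi * ((w k - w j) * t - (th k - th j))).
Proof.
move=> rel dlt; apply: kronecker => // a ha.
pose s := \sum_k a k.
pose b k := if k == j then a k - s else a k.
have bE (u : 'I_n -> R) :
    \sum_k (b k)%:~R * u k = \sum_k (a k)%:~R * (u k - u j).
  have -> : \sum_k (a k)%:~R * (u k - u j) =
      \sum_k (a k)%:~R * u k - s%:~R * u j.
    rewrite /s rmorph_sum /= mulr_suml -sumrB; apply: eq_bigr => k _.
    by rewrite mulrBr.
  rewrite (bigD1 j)//= [in RHS](bigD1 j)//= /b eqxx intrB.
  under eq_bigr => k /negbTE kj do rewrite kj.
  ring.
rewrite -bE; apply: rel; last by rewrite bE.
rewrite (bigD1 j)//= /b eqxx.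
under eq_bigr => k /negbTE kj do rewrite kj.
by rewrite /s [\sum_k _](bigD1 j)//=; ring.
Qed.

(** * Integer relations between the frequencies *)

Lemma sub_spanQ (R : realType) (A : set R) (x : R) : A x -> spanQ A x.
Proof.
move=> Ax; exists 1%N, (fun=> 1), (fun=> x); split => //.
by rewrite big_ord1 rmorph1 mul1r.
Qed.

Lemma spanQ_range (R : realType) (n : nat) (u : 'I_n -> R) (x : R) :
  spanQ (range u) x -> exists q : 'I_n -> rat, x = \sum_k ratr (q k) * u k.
Proof.
move=> [m [q [a [ha ->]]]].
have /choice[s hs] : forall i, exists k, a i = u k.
  by move=> i; have [k _ <-] := ha i; exists k.
exists (fun k => \sum_(i | s i == k) q i).
under [RHS]eq_bigr => k _ do rewrite rmorph_sum mulr_suml.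
rewrite (exchange_big_dep predT) //=; apply: eq_bigr => i _.
by rewrite (big_pred1 (s i)) ?hs// => k; rewrite eq_sym.
Qed.

(** Integer vectors a of sum zero that are orthogonal to w. *)
Definition affine_relation (R : realType) (n : nat) (w : 'I_n -> R)
    (a : 'I_n -> int) : Prop :=
  \sum_k a k = 0 /\ \sum_k (a k)%:~R * w k = 0.

(** The differences w k - w j span a space of dimension d, so the vectors
    orthogonal to all of them form a space of dimension N + 1 - d <= 2.  This
    space contains the j-th unit vector, whose sum is not zero, so at most one
    dimension is left for the affine relations. *)
Lemma affine_relation_proportional (R : realType) (N d : nat)
    (w : 'I_N.+1 -> R) (a b : 'I_N.+1 -> int) :
  is_affine_dimQ (range w) d -> (N <= d.+1)%N ->
  affine_relation w a -> affine_relation w b ->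
  forall k l, a k * b l = a l * b k.
Proof.
move=> [_ [j _ <-] [B [freeB spanB]]] Nd [a0 aw] [b0 bw].
pose beta k := w k - w j.
have betaE : [set w' - w j | w' in range w] = range beta.
  apply/seteqP; split=> [_ [_ [k _ <-] <-]|_ [k _ <-]]; first by exists k.
  by exists (w k) => //; exists k.
have hQ i : exists q : 'I_N.+1 -> rat, B i = \sum_k ratr (q k) * beta k.
  apply: spanQ_range; rewrite -betaE -spanB; apply: sub_spanQ; by exists i.
have hP k : exists p : 'I_d -> rat, beta k = \sum_i ratr (p i) * B i.
  apply: spanQ_range; rewrite spanB betaE; apply: sub_spanQ; by exists k.
move: hQ hP => /choice[Q hQ] /choice[P hP].
(* P and Q express the differences and the basis B in terms of each other. *)
pose MP := \matrix_(k < N.+1, i < d) P k i.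
pose MQ := \matrix_(i < d, k < N.+1) Q i k.
have comb (c : 'I_N.+1 -> rat) :
    \sum_k ratr (c k) * beta k = \sum_i ratr (\sum_k c k * P k i) * B i.
  under eq_bigr => k _ do rewrite hP mulr_sumr.
  rewrite exchange_big /=; apply: eq_bigr => i _.
  rewrite rmorph_sum mulr_suml; apply: eq_bigr => k _.
  by rewrite rmorphM mulrA.
have QP : MQ *m MP = 1%:M.
  apply/matrixP => i i'; rewrite !mxE.
  under eq_bigr => k _ do rewrite !mxE.
  apply/eqP; rewrite -subr_eq0; apply/eqP.
  apply: (freeB (fun i' => \sum_k Q i k * P k i' - (i == i')%:R)).
  under eq_bigr => l _ do rewrite rmorphB mulrBl.
  rewrite sumrB -comb -hQ (bigD1 i)//= eqxx rmorph1 mul1r.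
  rewrite big1 ?addr0 ?subrr// => l /negbTE li.
  by rewrite eq_sym li rmorph0 mul0r.
have ker (c : 'I_N.+1 -> rat) : \sum_k ratr (c k) * beta k = 0 ->
    forall i, \sum_k c k * P k i = 0.
  by rewrite comb => /freeB.
have relbeta (c : 'I_N.+1 -> int) : affine_relation w c ->
    \sum_k ratr ((c k)%:~R) * beta k = 0.
  move=> [c0 cw]; rewrite /beta.
  under eq_bigr => k _ do rewrite ratr_int mulrBr.
  by rewrite sumrB cw -mulr_suml -rmorph_sum c0 mul0r subrr.
(* The rows of M: the j-th unit vector, a and b. *)
pose u (r : 'I_3) (k : 'I_N.+1) : rat :=
  if val r == 0%N then (k == j)%:R
  else if val r == 1%N then (a k)%:~R else (b k)%:~R.
pose M := \matrix_(r < 3, k < N.+1) u r k.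
have MP0 : M *m MP = 0.
  apply/matrixP => r i; rewrite !mxE.
  under eq_bigr => k _ do rewrite !mxE.
  apply: ker; rewrite /u; case: (val r == 0%N); last first.
    by case: (val r == 1%N); exact: relbeta.
  rewrite (bigD1 j)//= big1; first by rewrite /beta subrr mulr0 addr0.
  by move=> k /negbTE ->; rewrite rmorph0 mul0r.
have rkP : (d <= \rank MP)%N.
  by have := mxrankM_maxr MQ MP; rewrite QP mxrank1.
have rkM : (\rank M <= 2)%N.
  have : (M <= kermx MP)%MS by apply/sub_kermxP.
  move=> /mxrankS; rewrite mxrank_ker => /leq_trans; apply.
  by rewrite leq_subLR; lia.
have : kermx M != 0.
  rewrite kermx_eq0 /row_free; apply/negP => /eqP rk3.
  by move: rkM; rewrite rk3.
move=> /rowV0Pn[v /sub_kermxP vM v0].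
have vE k : v 0 (inord 0) * (k == j)%:R + v 0 (inord 1) * (a k)%:~R
    + v 0 (inord 2) * (b k)%:~R = 0.
  have := congr1 (fun A : 'rV_N.+1 => A 0 k) vM.
  rewrite !mxE !big_ord_recl big_ord0 !mxE /u /= addr0 addrA.
  move=> h; rewrite -[RHS]h.
  congr (v 0 _ * _ + v 0 _ * _ + v 0 _ * _);
    by apply: val_inj; rewrite /= inordK.
have x0 : v 0 (inord 0) = 0.
  have : \sum_k (v 0 (inord 0) * (k == j)%:R + v 0 (inord 1) * (a k)%:~R
    + v 0 (inord 2) * (b k)%:~R) = 0 by apply: big1.
  rewrite !big_split /= -!mulr_sumr -!rmorph_sum a0 b0 !mulr0 !addr0.
  rewrite (bigD1 j)//= eqxx big1 ?addr0 ?mulr1// => k /negbTE -> //.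
have {}vE k : v 0 (inord 1) * (a k)%:~R = - (v 0 (inord 2) * (b k)%:~R).
  by apply/eqP; rewrite -addr_eq0; move: (vE k); rewrite x0 mul0r add0r => ->.
move=> k l; apply/eqP.
rewrite -(eqr_int rat) !intrM -subr_eq0; apply: contraT => nz.
have y0 : v 0 (inord 1) = 0.
  apply: (mulIf nz); rewrite mul0r mulrBr !mulrA !vE; ring.
have z0 : v 0 (inord 2) = 0.
  have {}vE m : v 0 (inord 2) * (b m)%:~R = 0.
    by have := vE m; rewrite y0 mul0r => /eqP; rewrite eq_sym oppr_eq0 => /eqP.
  apply: (mulIf nz); rewrite mul0r mulrBr ![v _ _ * (_ * _)]mulrCA !vE.
  by rewrite !mulr0 subrr.
suff : v = 0 by move=> /eqP; rewrite (negbTE v0).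
apply/rowP => i; rewrite [RHS]mxE.
have -> : i = inord (val i) by apply: val_inj; rewrite /= inordK.
by case: i => -[|[|[|]]].
Qed.

(** A group of integer vectors that are pairwise proportional is cyclic: a
    generator has a minimal nonzero entry at some index k0, by Euclidean
    division. *)
Lemma int_module_generator (n : nat) (V : ('I_n -> int) -> Prop) :
  V (fun=> 0) ->
  (forall a b (q : int), V a -> V b -> V (fun k => b k - q * a k)) ->
  (forall a b, V a -> V b -> forall k l, a k * b l = a l * b k) ->
  exists2 a, V a & forall b, V b -> exists q : int, forall k, b k = q * a k.
Proof.
move=> V0 Vsub prop.
have [Vtriv|] := pselect (forall b, V b -> forall k, b k = 0).
  exists (fun=> 0) => // b Vb; exists 0 => k; by rewrite Vtriv// mul0r.
move=> /existsNP[c /not_implyP[Vc /existsNP[k0 /eqP ck0]]].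
have ex : exists m, `[< exists2 a, V a & `|a k0|%N = m.+1 >].
  exists (`|c k0|%N.-1); apply/asboolP; exists c => //.
  by rewrite prednK// absz_gt0.
case: (ex_minnP ex) => m /asboolP[a Va am] mmin.
exists a => // b Vb; exists (b k0 %/ a k0)%Z => k.
have ak0 : a k0 != 0 by rewrite -absz_eq0 am.
pose r := fun k => b k - (b k0 %/ a k0)%Z * a k.
have Vr : V r by exact: Vsub.
have rk0 : r k0 = 0.
  have rE : r k0 = (b k0 %% a k0)%Z by [].
  apply: contrapT => /eqP rn0.
  have := mmin (`|r k0|%N.-1); rewrite leqNgt => /(_ _) /negP; apply.
    apply/asboolP; exists r => //; by rewrite prednK// absz_gt0.
  have : (`|r k0| < `|a k0|)%N.
    by rewrite -ltz_nat gez0_abs rE ?modz_ge0// ltz_mod.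
  by rewrite am; move: rn0; rewrite -absz_gt0; lia.
have := prop _ _ Vr Va k k0; rewrite rk0 mul0r => /eqP.
by rewrite mulf_eq0 (negbTE ak0) orbF subr_eq0 => /eqP.
Qed.

Lemma affine_relation_generator (R : realType) (N d : nat)
    (w : 'I_N.+1 -> R) :
  is_affine_dimQ (range w) d -> (N <= d.+1)%N ->
  exists2 a, affine_relation w a &
    forall b, affine_relation w b -> exists q : int, forall k, b k = q * a k.
Proof.
move=> dimd Nd; apply: int_module_generator.
- by split; rewrite big1// => k _; rewrite mul0r.
- move=> a b q [a0 aw] [b0 bw]; split.
    by rewrite sumrB b0 -mulr_sumr a0 mulr0 subrr.
  under eq_bigr => k _ do rewrite intrB intrM mulrBl -mulrA.
  by rewrite sumrB bw -mulr_sumr aw mulr0 subrr.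
- by move=> a b; exact: affine_relation_proportional dimd Nd.
Qed.

(** * Translations of the line and almost everywhere properties *)

Lemma measurable_translation (R : realType) (s : R) :
  measurable_fun setT
    ((fun t => t + s) : measurableTypeR R -> measurableTypeR R).
Proof. exact: measurable_funD. Qed.

Lemma lebesgue_measure_translation (R : realType) (s : R) (A : set R) :
  measurable A ->
  pushforward (@lebesgue_measure R)
    ((fun t => t + s) : _ -> measurableTypeR R) A = lebesgue_measure A.
Proof.
move=> mA; apply/esym/lebesgue_measure_unique => //=.
  exact: measurable_translation.
move=> _ _ [[a b]] _ <-; rewrite /pushforward /=.
have -> : (fun t : R => t + s) @^-1` `]a, b] = `]a - s, b - s]%classic.
  by apply/seteqP; split => t; rewrite /= !in_itv /= ltrBlDr lerBrDr.
rewrite !lebesgue_measure_itv /= !lte_fin ltrD2r; case: ifP => // _.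
by rewrite -!EFinB; congr (_%:E); ring.
Qed.

Lemma ge0_integral_translation (R : realType) (s : R) (D : set R)
    (h : R -> \bar R) :
  measurable D -> measurable_fun setT h -> (forall t, (0 <= h t)%E) ->
  (\int[@lebesgue_measure R]_(t in (fun t : R => (t + s)%R) @^-1` D)
     h (t + s)%R =
   \int[@lebesgue_measure R]_(t in D) h t)%E.
Proof.
move=> mD mh h0.
rewrite -(@ge0_integral_pushforward _ _ _ _ _ _ (measurable_translation s)
  (@lebesgue_measure R) D h)//; last exact: measurable_funS mh.
apply: eq_measure_integral => [|m A mA _]; first exact: measurable_translation.
exact: lebesgue_measure_translation.
Qed.

Lemma ae_translation (R : realType) (s : R) (P : R -> Prop) :
  {ae @lebesgue_measure R, forall t, P t} ->
  {ae @lebesgue_measure R, forall t, P (t + s)}.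
Proof.
move=> [A [mA A0 PA]]; exists ((fun t => t + s) @^-1` A); split.
- by rewrite -[X in measurable X]setTI; exact: measurable_translation.
- by rewrite -[RHS]A0 -(lebesgue_measure_translation s mA).
- by move=> t Pt; apply: PA.
Qed.

Lemma ae_lebesgue_filter (R : realType) :
  Filter (nbhs (almost_everywhere (@lebesgue_measure R))).
Proof. exact: ae_filter_ringOfSetsType. Qed.

Lemma ae_near_exists (R : realType) (t0 : R) (P Q : R -> Prop) :
  {ae @lebesgue_measure R, forall t, P t} -> (\forall t \near t0, Q t) ->
  exists2 t, Q t & P t.
Proof.
move=> [A [mA A0 PA]] /nbhs_ballP[e /= e0 Qe].
apply: contrapT => /forall2NP H.
have BA : ball t0 e `<=` A.
  by move=> t /Qe Qt; apply: PA => /= Pt; case: (H t).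
have : (lebesgue_measure (ball t0 e) <= lebesgue_measure A)%E.
  by apply: le_measure; rewrite ?inE//; exact: measurable_ball.
rewrite (lebesgue_measure_ball _ (ltW e0)) A0 lee_fin leNgt => /negP; apply.
by rewrite mulrn_wgt0.
Qed.

(** * Two-term relations *)

(** The integrals of h over the disjoint intervals
    [x + n s, x + n s + |s|[ do not decrease with n, and their sum is finite,
    so they all vanish. *)
Lemma integral_eq0_of_shift_le (R : realType) (h : R -> R) (s x : R) :
  measurable_fun setT h -> (forall t, 0 <= h t) ->
  (\int[@lebesgue_measure R]_t (h t)%:E < +oo)%E ->
  s != 0 ->
  {ae @lebesgue_measure R, forall t, h t <= h (t + s)} ->
  (\int[@lebesgue_measure R]_(t in `[x, (x + `|s|)%R[) (h t)%:E = 0)%E.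
Proof.
move=> mh h0 hfin s0 hs.
have mhE : measurable_fun setT (EFin \o h) by exact/measurable_EFinP.
pose D n : set R := `[x + s *+ n, (x + s *+ n + `|s|)%R[%classic.
pose J n := (\int[@lebesgue_measure R]_(t in D n) (h t)%:E)%E.
have mD n : measurable (D n) by exact: measurable_itv.
have JS n : (J n <= J n.+1)%E.
  have hE t : (0 <= (EFin \o h) t)%E by rewrite lee_fin.
  rewrite /J -[leRHS](ge0_integral_translation s (mD n.+1) mhE hE).
  have -> : (fun t => t + s) @^-1` D n.+1 = D n.
    apply/seteqP; split => t; rewrite /D /= !in_itv /= mulrS => /andP[? ?];
    apply/andP; split; lra.
  apply: ae_ge0_le_integral => //.
  - exact: mD.
  - by move=> t _; rewrite lee_fin.
  - exact: (measurable_funS measurableT (@subsetT _ _) mhE).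
  - apply: (measurable_funS measurableT (@subsetT _ _)).
    exact: (measurableT_comp mhE (measurable_translation s)).
  - by apply: negligibleS hs; apply: subsetC => t /= ht _; rewrite lee_fin.
have J0 n : (J 0%N <= J n)%E.
  by elim: n => // n /le_trans; apply.
have Dtriv : trivIset setT D.
  move=> i j _ _ [t []]; rewrite /D /= !in_itv /= => /andP[i1 i2] /andP[j1 j2].
  apply/eqP/negPn/negP => ij.
  have d1 : `|s *+ i - s *+ j| < `|s|.
    by rewrite ltr_norml; apply/andP; split; lra.
  move: d1; rewrite -(mulr_natl s i) -(mulr_natl s j) -mulrBl normrM.
  rewrite gtr_pMl ?normr_gt0// ltNge => /negP; apply.
  have : (1 <= `|i%:Z - j%:Z|)%R by lia.
  by rewrite -(ler_int R) intr_norm intrB.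
have bound n : (n%:R%:E * J 0%N <= \int[@lebesgue_measure R]_t (h t)%:E)%E.
  apply: (@le_trans _ _ (\sum_(i <- iota 0 n) J i)%E).
    elim: n => [|n IHn]; first by rewrite mul0e big_nil.
    rewrite -addn1 iotaD add0n big_cat /= big_seq1 natrD EFinD.
    by rewrite ge0_muleDl ?lee_fin// mul1e leeD.
  rewrite -ge0_integral_bigsetU//.
  - apply: ge0_subset_integral => //.
    + by apply: bigsetU_measurable => i _; exact: mD.
    + by move=> t _; rewrite lee_fin.
  - exact: iota_uniq.
  - exact: sub_trivIset Dtriv.
  - exact: (measurable_funS measurableT (@subsetT _ _) mhE).
  - by move=> t _; rewrite lee_fin.
have J0ge : (0 <= J 0%N)%E by apply: integral_ge0 => t _; rewrite lee_fin.
have -> : (\int[@lebesgue_measure R]_(t in `[x, (x + `|s|)%R[) (h t)%:E)%E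
   = J 0%N by rewrite /J /D mulr0n addr0.
move: bound hfin; case: (integral _ _ _) => [c||] // bound _; last first.
  by move: (bound 0%N); rewrite mul0e.
move: J0ge bound; case: (J 0%N) => [a||] //.
  rewrite lee_fin => a0 bound; congr (_%:E); apply/eqP.
  rewrite eq_le a0 andbT; apply: (@le_of_muln_le _ _ _ c) => M.
  by have := bound M; rewrite -EFinM lee_fin mulr0 add0r.
by move=> _ /(_ 1%N); rewrite mul1e.
Qed.

Lemma two_term_relation (R : realType) (f : R -> R[i]) (c1 c2 : R[i])
    (t1 t2 : R) :
  in_L2 f -> ultimately_positive f -> t1 != t2 ->
  {ae @lebesgue_measure R, forall t, c1 * f (t - t1) + c2 * f (t - t2) = 0} ->
  c1 = 0.
Proof.
move=> [g [mRe mIm gfin fg]] [t0 fpos] t12 rel; apply: contrapT => /eqP c1n0.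
pose h t := normc (g t) ^+ 2.
have h0 t : 0 <= h t by rewrite exprn_ge0// normc_ge0.
have mh : measurable_fun setT h.
  have -> : h = (fun t => complex.Re (g t) ^+ 2 + complex.Im (g t) ^+ 2).
    apply/funext => t; rewrite /h; case: (g t) => a b /=.
    by rewrite sqr_sqrtr// addr_ge0// sqr_ge0.
  by apply: measurable_funD; exact: measurable_funX.
have c2n0 : c2 != 0.
  apply/eqP => c20.
  have : \forall t \near (t0 + t1 + 1), t0 + t1 < t.
    by apply: lt_nbhsr; rewrite ltrDl.
  move=> /(ae_near_exists rel)[t tgt]; rewrite c20 mul0r addr0 => /eqP.
  rewrite mulf_eq0 (negbTE c1n0)/= => /eqP ft0.
  by have := fpos (t - t1); rewrite ft0 ltxx lerBrDr ltW// => /(_ isT).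
have aeF := ae_lebesgue_filter R.
set N1 := normc c1; set N2 := normc c2.
have N1p : 0 < N1 ^+ 2 by rewrite exprn_gt0// normc_gt0.
have N2p : 0 < N2 ^+ 2 by rewrite exprn_gt0// normc_gt0.
have hrel : {ae @lebesgue_measure R, forall t,
    N1 ^+ 2 * h t = N2 ^+ 2 * h (t + (t1 - t2))}.
  have fg2 := ae_translation (t1 - t2) fg.
  have rel1 := ae_translation t1 rel.
  move: fg fg2 rel1; apply: filterS3 => t /= e1 e2.
  rewrite addrK -addrA e1 e2 => /eqP; rewrite addr_eq0 => /eqP e3.
  by rewrite /h -!exprMn -!normcM e3 normcN.
(* The direction of the shift depends on which of c1, c2 is the larger. *)
have [s s0 hs] : exists2 s, s != 0 &
    {ae @lebesgue_measure R, forall t, h t <= h (t + s)}.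
  have [N12|N12] := leP (N2 ^+ 2) (N1 ^+ 2).
    exists (t1 - t2); first by rewrite subr_eq0.
    move: hrel; apply: filterS => t /= e.
    by rewrite -(ler_pM2l N2p) -e ler_wpM2r.
  exists (t2 - t1); first by rewrite subr_eq0 eq_sym.
  have hrel' := ae_translation (t2 - t1) hrel.
  move: hrel'; apply: filterS => t /= e.
  rewrite -(ler_pM2l N1p) e.
  have -> : t + (t2 - t1) + (t1 - t2) = t by ring.
  by rewrite ler_wpM2r// ltW.
have I0 := integral_eq0_of_shift_le t0 mh h0 gfin s0 hs.
pose D : set R := `[t0, t0 + `|s|[%classic.
have mhD : measurable_fun D (EFin \o h).
  apply: (measurable_funS measurableT (@subsetT _ _)).
  exact/measurable_EFinP.
have haeD : ae_eq lebesgue_measure D (EFin \o h) (cst 0%E).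
  have mD : measurable D by exact: measurable_itv.
  apply: (ae_eq_integral_abs (@lebesgue_measure R) mD mhD).1.
  rewrite -[RHS]I0; apply: eq_integral => t _ /=.
  by rewrite ger0_norm.
have sp : 0 < `|s| by rewrite normr_gt0.
have hae : {ae @lebesgue_measure R, forall t, (D t -> h t = 0) /\ f t = g t}.
  by move: haeD fg; apply: filterS2 => t /= e1 e2; split=> // /e1 [].
have near1 : \forall t \near (t0 + `|s| / 2), t0 < t < t0 + `|s|.
  by apply: near_in_itvoo; rewrite in_itv /=; apply/andP; split; lra.
have [t /andP[tl tr] [/= hD0 fgt]] := ae_near_exists hae near1.
have ht0 : h t = 0 by apply: hD0; rewrite /D /= in_itv /= (ltW tl) tr.
have := fpos t (ltW tl); rewrite fgt.
suff -> : g t = 0 by rewrite ltxx.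
by apply: eq0_normc; move/eqP: ht0; rewrite sqrf_eq0 => /eqP.
Qed.

(** * Choice of the phases *)

Lemma polar_form (R : realType) (z : R[i]) :
  exists alpha : R, z = (normc z)%:C * cexp alpha.
Proof.
have [->|zn0] := eqVneq z 0; first by exists 0; rewrite normc0 mul0r.
have npos := normc_gt0 zn0.
move: npos; case: z {zn0} => a b; rewrite /=; set r := Num.sqrt _ => r0.
have r2 : r ^+ 2 = a ^+ 2 + b ^+ 2 by rewrite sqr_sqrtr// addr_ge0// sqr_ge0.
have rn0 : r != 0 by rewrite gt_eqF.
have uv : (a / r) ^+ 2 + (b / r) ^+ 2 = 1.
  by rewrite !expr_div_n -mulrDl -r2 divff// expf_neq0.
have u1 : -1 <= a / r <= 1.
  have := sqr_ge0 (b / r); rewrite -ler_norml => ?.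
  rewrite -(@ler_sqr _ `|a / r| 1) ?nnegrE// real_normK ?num_real// expr1n; lra.
have pi2 : 2 * pi != 0 :> R by rewrite mulf_neq0// gt_eqF// pi_gt0.
have cosu : cos (acos (a / r)) = a / r by apply: acosK; rewrite in_itv.
have sinu : sin (acos (a / r)) = `|b / r|.
  rewrite sin_acos// -(addrK ((a / r) ^+ 2) 1) -uv.
  by rewrite -sqrtr_sqr; congr Num.sqrt; ring.
exists (if 0 <= b / r then acos (a / r) / (2 * pi)
        else - acos (a / r) / (2 * pi)).
have -> : cexp (if 0 <= b / r then acos (a / r) / (2 * pi)
        else - acos (a / r) / (2 * pi)) = (a / r) +i* (b / r).
  rewrite /cexp; case: ifPn => br.
    by rewrite mulrC divfK// cosu sinu ger0_norm.
  by rewrite mulrC divfK// cosN sinN cosu sinu ltr0_norm ?opprK// ltNge.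
apply/eqP; rewrite eq_complex /= !mul0r subr0 addr0.
by rewrite ![r * _]mulrC !divfK// !eqxx.
Qed.

Lemma cosD_gt0 (R : realType) (x y : R) :
  0 < cos x -> 0 < cos y -> 1 < cos x ^+ 2 + cos y ^+ 2 -> 0 < cos (x + y).
Proof.
move=> cx cy h; rewrite cosD subr_gt0.
have cc : 0 < cos x * cos y by rewrite mulr_gt0.
apply: le_lt_trans (ler_norm _) _.
rewrite -(@ltr_sqr _ _ (cos x * cos y)) ?nnegrE ?(ltW cc)//.
rewrite real_normK ?num_real// !exprMn !sin2cos2; lra.
Qed.

(** A margin delta such that phases with cosines C k > 0 and y > 1 - delta add
    up to a phase of positive cosine, by [cosD_gt0]. *)
Lemma exists_margin (R : realFieldType) (I : finType) (C : I -> R) :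
  (forall k, C k <= 1) ->
  exists2 delta, 0 < delta <= 1 &
    forall k, 0 < C k -> 1 < (1 - delta) ^+ 2 + C k ^+ 2.
Proof.
move=> C1; pose D k := if 0 < C k then C k ^+ 2 else 1.
have D01 k : 0 < D k <= 1.
  rewrite /D; case: ifP => [c0|_]; last by rewrite ltr01 lexx.
  by rewrite exprn_gt0//= expr_le1// ltW.
have P0 : 0 < \prod_k D k by apply: prodr_gt0 => k _; case/andP: (D01 k).
have PD k : \prod_k D k <= D k.
  rewrite (bigD1 k)//= ler_piMr//; first by case/andP: (D01 k) => /ltW.
  rewrite -[leRHS](@big1_eq R 1 *%R _ (index_enum I) (fun i => i != k)).
  apply: ler_prod => i _.
  by case/andP: (D01 i) => /ltW -> ->.
have P1 : \prod_k D k <= 1.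
  rewrite -[leRHS](@big1_eq R 1 *%R _ (index_enum I) xpredT).
  by apply: ler_prod => i _; case/andP: (D01 i) => /ltW -> ->.
exists (\prod_k D k / 2); first by apply/andP; split; lra.
move=> k Ck; have := PD k; rewrite /D Ck -/(D _).
set p := \prod_k D k in P0 P1 *; nra.
Qed.

(** Let th be phases compatible with the integer relations between the w k,
    such that for each k the number c k * exp(2 i pi (th k)) is in the open
    right half-plane or, w k being equal to w j, the number
    c k * exp(2 i pi (th j)) is on the imaginary axis.  Here c k is replaced by
    its unit factor exp(2 i pi (alpha k)).  The coefficients of the first kind
    vanish: otherwise the real part of the relation, rotated so that the phase
    of index j is exactly th j, is positive at times t given by Kronecker's
    theorem. *)
Lemma phase_selection (R : realType) (n : nat) (f : R -> R[i])
    (tau w alpha th : 'I_n -> R) (c : 'I_n -> R[i]) (j : 'I_n) :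
  ultimately_positive f ->
  {ae @lebesgue_measure R, forall t,
     \sum_k c k * (cexp (w k * t) * f (t - tau k)) = 0} ->
  (forall k, c k = (normc (c k))%:C * cexp (alpha k)) ->
  (forall a, affine_relation w a -> cexp (\sum_k (a k)%:~R * th k) = 1) ->
  (forall k, 0 < cos (2 * pi * (alpha k + th k)) \/
     (w k = w j /\ cos (2 * pi * (alpha k + th j)) = 0)) ->
  forall k, 0 < cos (2 * pi * (alpha k + th k)) -> c k = 0.
Proof.
move=> [t0 fpos] rel polarc relth dich k1 k1A; apply/eqP/negPn/negP => ck1.
have [delta dlt margin] := @exists_margin R 'I_n
  (fun k => cos (2 * pi * (alpha k + th k))) (fun k => cos_le1 _).
pose T := t0 + \sum_k `|tau k|.
have [t1 Tt1 ht1] := @kronecker_affine R n w th j (T + 1) delta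
  (fun a a0 aw => relth a (conj a0 aw)) dlt.
have nearc : \forall t \near t1, T < t /\ forall k,
    1 - delta < cos (2 * pi * ((w k - w j) * t - (th k - th j))).
  have nearT : \forall t \near t1, T < t by apply: lt_nbhsr; lra.
  suff nearcos : \forall t \near t1, forall k,
      1 - delta < cos (2 * pi * ((w k - w j) * t - (th k - th j))).
    by move: nearT nearcos; apply: filterS2.
  apply: (@filter_forall _ _ (fun k t =>
      1 - delta < cos (2 * pi * ((w k - w j) * t - (th k - th j))))
      _ (nbhs_filter t1)) => k.
  have /cvgr_gt : (fun t => cos (2 * pi * ((w k - w j) * t - (th k - th j))))
      @ t1 --> cos (2 * pi * ((w k - w j) * t1 - (th k - th j))).
    apply: (@continuous_comp _ _ _
      (fun t => 2 * pi * ((w k - w j) * t - (th k - th j))) cos);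
      last exact: continuous_cos.
    apply: cvgM; first exact: cvg_cst.
    apply: cvgB; last exact: cvg_cst.
    by apply: cvgM; [exact: cvg_cst|exact: cvg_id].
  by apply; exact: ht1.
have [t [Tt ht] relt] := ae_near_exists rel nearc.
have fp k : 0 < f (t - tau k).
  apply: fpos; rewrite lerBrDr; apply: le_trans (ltW Tt).
  rewrite /T lerD2l (le_trans (ler_norm _))// (bigD1 k)//= lerDl.
  exact: sumr_ge0.
pose F k := complex.Re (f (t - tau k)).
have Fp k : 0 < F k by have := fp k; rewrite ltcE => /andP[].
have fF k : f (t - tau k) = (F k)%:C.
  have := fp k; rewrite ltcE /F => /andP[/eqP /= im0 _].
  by move: im0; case: (f _) => x y /= ->.
pose ph k := alpha k + th j + (w k - w j) * t.
have sum0 : \sum_k normc (c k) * F k * cos (2 * pi * ph k) = 0.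
  have Re0 : complex.Re (cexp (th j - w j * t) *
      \sum_k c k * (cexp (w k * t) * f (t - tau k))) = 0.
    by rewrite relt mulr0.
  rewrite -[RHS]Re0 mulr_sumr Re_sum; apply: eq_bigr => k _.
  rewrite fF [in RHS](polarc k).
  have -> : cexp (th j - w j * t) *
      ((normc (c k))%:C * cexp (alpha k) * (cexp (w k * t) * (F k)%:C)) =
      (normc (c k) * F k)%:C * cexp (ph k).
    have -> : ph k = (th j - w j * t) + alpha k + w k * t by rewrite /ph; ring.
    by rewrite !cexpD (rmorphM (real_complex R)); ring.
  by rewrite Re_realM.
have phA k : 0 < cos (2 * pi * (alpha k + th k)) -> 0 < cos (2 * pi * ph k).
  move=> kA.
  have -> : 2 * pi * ph k = 2 * pi * (alpha k + th k) +
     2 * pi * ((w k - w j) * t - (th k - th j)) by rewrite /ph; ring.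
  have := margin k kA; have := ht k; move: kA.
  set x := cos _ => x0; set y := cos _ => hy hm.
  case/andP: dlt => d0 d1.
  have y0 : 0 < y by apply: le_lt_trans hy; lra.
  apply: cosD_gt0 => //; rewrite -/x -/y; apply: lt_le_trans hm _.
  rewrite addrC lerD2l lerXn2r ?nnegrE ?subr_ge0//; exact: ltW.
have phge k : 0 <= cos (2 * pi * ph k).
  case: (dich k) => [/phA/ltW//|[wk ck]].
  by rewrite /ph wk subrr mul0r addr0 ck.
have ck1p := normc_gt0 ck1.
have : 0 < \sum_k normc (c k) * F k * cos (2 * pi * ph k).
  rewrite (bigD1 k1)//= ltr_pwDl//.
    by rewrite !mulr_gt0// phA.
  by apply: sumr_ge0 => k _; rewrite !mulr_ge0 ?normc_ge0// ltW.
by rewrite sum0 ltxx.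
Qed.

Lemma cos_gt0_quarter (R : realType) (x : R) :
  `|x| < 1 / 4 -> 0 < cos (2 * pi * x).
Proof.
rewrite ltr_norml => /andP[x1 x2]; have := pi_gt0 R => p0.
apply: cos_gt0_pihalf; apply/andP; split; nra.
Qed.

Lemma cos_quarter_int (R : realType) (z : int) (x : R) :
  x = 1 / 4 + z%:~R \/ x = - (1 / 4) + z%:~R -> cos (2 * pi * x) = 0.
Proof.
have cosE y : cos (2 * pi * (y + z%:~R)) = cos (2 * pi * y) :> R.
  have := congr1 (@complex.Re R) (cexpD y z%:~R).
  by rewrite cexp_int mulr1.
have q : 2 * pi * (1 / 4) = pi / 2 :> R by field.
by case=> ->; rewrite cosE ?mulrN ?cosN q cos_pihalf.
Qed.

(** Phases compatible with a generator are compatible with all relations. *)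
Lemma affine_relation_phase (R : realType) (n : nat) (w th : 'I_n -> R)
    (a : 'I_n -> int) (z : int) :
  (forall b, affine_relation w b -> exists q : int, forall k, b k = q * a k) ->
  \sum_k (a k)%:~R * th k = z%:~R ->
  forall b, affine_relation w b -> cexp (\sum_k (b k)%:~R * th k) = 1.
Proof.
move=> gen az b /gen[q bq].
under eq_bigr => k _ do rewrite bq intrM -mulrA.
by rewrite -mulr_sumr az -intrM cexp_int.
Qed.

Lemma int_sum0_signs (n : nat) (a : 'I_n -> int) :
  \sum_k a k = 0 -> (exists k, a k != 0) ->
  exists p q, 0 < a p /\ a q < 0.
Proof.
move=> a0 [k0 k0n].
have sgn (b : 'I_n -> int) : \sum_k b k = 0 -> b k0 != 0 -> exists p, 0 < b p.
  move=> b0 bk0; apply: contrapT => H.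
  have bneg k : 0 <= - b k.
    by rewrite oppr_ge0 leNgt; apply/negP => bk; apply: H; exists k.
  have /eqP : \sum_k - b k = 0 by rewrite sumrN b0 oppr0.
  rewrite psumr_eq0// => /allP/(_ k0); rewrite mem_index_enum => /(_ isT).
  by rewrite oppr_eq0 (negbTE bk0).
have [p ap] := sgn a a0 k0n.
have [||q aq] := sgn (fun k => - a k).
- by rewrite sumrN a0 oppr0.
- by rewrite oppr_eq0.
by exists p, q; rewrite ap -oppr_gt0.
Qed.

(** The phases -alpha can be corrected by less than a quarter turn so as to
    satisfy the relation a modulo 1, unless a is a difference of two unit
    vectors e_p - e_q and alpha p - alpha q is 1/2 modulo 1. *)
Lemma phase_correction (R : realType) (n : nat) (a : 'I_n -> int)
    (alpha : 'I_n -> R) :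
  \sum_k a k = 0 ->
  (exists phi : 'I_n -> R, (forall k, `|phi k| < 1 / 4) /\
    exists z : int, \sum_k (a k)%:~R * (phi k - alpha k) = z%:~R) \/
  (exists p q, [/\ p != q, forall k, a k = (k == p)%:Z - (k == q)%:Z &
    exists z : int, alpha p - alpha q = 1 / 2 + z%:~R]).
Proof.
move=> a0.
pose s := \sum_k (a k)%:~R * alpha k.
(* s' represents s modulo 1 in [-1/2, 1/2[. *)
pose m := Num.floor (s + 1 / 2).
pose s' := s - m%:~R.
have s'1 : - (1 / 2) <= s'.
  have := Num.Theory.floor_le (s + 1 / 2); rewrite /s' -/m; lra.
have s'2 : s' < 1 / 2.
  have := Num.Theory.floorD1_gt (s + 1 / 2); rewrite -/m intrD /s'; lra.
have s'n : `|s'| <= 1 / 2 by rewrite ler_norml s'1 ltW.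
pose S : int := \sum_k `|a k|.
(* The correction s' is spread evenly, up to signs, over the support of a. *)
have spread : 0 < S -> `|s'| < S%:~R / 4 ->
    exists phi : 'I_n -> R, (forall k, `|phi k| < 1 / 4) /\
    exists z : int, \sum_k (a k)%:~R * (phi k - alpha k) = z%:~R.
  move=> S0 hS.
  have SR : 0 < S%:~R :> R by rewrite ltr0z.
  exists (fun k => (Num.sg (a k))%:~R * (s' / S%:~R)); split.
    move=> k; apply: (@le_lt_trans _ _ (`|s'| / S%:~R)).
      rewrite !normrM [`|_^-1|]gtr0_norm ?invr_gt0// ler_piMl//.
        by rewrite divr_ge0// ltW.
      by rewrite -intr_norm normr_sg lerz1; case: (a k == 0).
    by rewrite ltr_pdivrMr// mulrC mul1r.
  exists (- m).
  under eq_bigr => k _ do rewrite mulrBr mulrA -intrM [a k * _]mulrC -normrEsg.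
  rewrite sumrB -mulr_suml -rmorph_sum -/S -/s mulrC divfK ?gt_eqF//.
  by rewrite /s' mulrNz; ring.
have [az|/existsNP[k0 /eqP ak0]] := pselect (forall k, a k = 0).
  left; exists (fun=> 0); split; first by move=> k; rewrite normr0; lra.
  by exists 0; rewrite big1// => k _; rewrite az mul0r.
have [p [q [ap aq]]] := int_sum0_signs a0 (ex_intro _ k0 ak0).
have pq : p != q by apply/eqP => pq; move: ap aq; rewrite pq; lia.
pose rest := \sum_(k | (k != p) && (k != q)) `|a k|.
have SE : S = a p - a q + rest.
  rewrite /S (bigD1 p)//= (bigD1 q)//= 1?eq_sym// /rest.
  by rewrite (gtr0_norm ap) (ltr0_norm aq) addrA.
have rest0 : 0 <= rest by exact: sumr_ge0.
have S2 : 2 <= S by lia.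
have S0 : 0 < S by lia.
have SR2 : 2 <= S%:~R :> R by rewrite (ler_int R 2).
have [S3|S3] := leP 3 S.
  left; apply: spread => //.
  have : 3 <= S%:~R :> R by rewrite (ler_int R 3).
  lra.
have [half|nhalf] := eqVneq s' (- (1 / 2)); last first.
  left; apply: spread => //; apply: (@lt_le_trans _ _ (1 / 2)); last lra.
  by rewrite ltr_norml s'2 lt_neqAle s'1 eq_sym nhalf.
right; exists p, q.
have ap1 : a p = 1 by lia.
have aq1 : a q = -1 by lia.
have ak k : k != p -> k != q -> a k = 0.
  move=> kp kq; have r0 : rest = 0 by lia.
  have : `|a k| <= rest.
    by rewrite /rest (bigD1 k) ?kp//= lerDl sumr_ge0.
  by rewrite r0 normr_le0 => /eqP.
have aE k : a k = (k == p)%:Z - (k == q)%:Z.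
  have [->|kp] := eqVneq k p; first by rewrite (negbTE pq) ap1.
  by have [->|kq] := eqVneq k q; [rewrite aq1|rewrite ak].
split => //; exists (m - 1).
have sE : s = alpha p - alpha q.
  rewrite /s (bigD1 p)//= (bigD1 q) 1?eq_sym//= big1; last first.
    by move=> k /andP[kp kq]; rewrite ak// mul0r.
  by rewrite ap1 aq1 mul1r mulNr mul1r addr0.
by rewrite -sE intrB; move: half; rewrite /s' => h; lra.
Qed.

(** * Linear independence *)

Theorem theorem1p4 (R : realType) (f : R -> R[i]) (N : nat)
    (Lambda : 'I_N.+1 -> R * R) (d : nat)
    (f_L2 : in_L2 f) (f_pos : ultimately_positive f)
    (Lambda_inj : injective Lambda)
    (dim_d : is_affine_dimQ (range (fun k => (Lambda k).2)) d)
    (d_ge : (N%:Z - 1 <= d%:Z)%R) :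
  lin_indep_ae (gabor f Lambda).
Proof.
move=> c rel0.
pose w k := (Lambda k).2; pose tau k := (Lambda k).1.
have rel : {ae @lebesgue_measure R, forall t,
    \sum_k c k * (cexp (w k * t) * f (t - tau k)) = 0}.
  have aeF := ae_lebesgue_filter R.
  move: rel0; apply: filterS => t /= h.
  rewrite -[RHS]h; apply: eq_bigr => k _.
  by rewrite /gabor /modulation /translation /cexp -!mulrA.
have /choice[alpha polarc] k : exists al, c k = (normc (c k))%:C * cexp al.
  exact: polar_form.
have Nd : (N <= d.+1)%N by lia.
have [a [a0 aw] gen] := affine_relation_generator dim_d Nd.
have [[phi [phi4 [z az]]]|[p [q [pq aE [z hz]]]]] := phase_correction alpha a0.
  move=> k.
  have cosp k' : 0 < cos (2 * pi * (alpha k' + (phi k' - alpha k'))).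
    by rewrite addrC subrK cos_gt0_quarter.
  apply: (@phase_selection R N.+1 f tau w alpha (fun k => phi k - alpha k) c k
    f_pos rel polarc _ _ k (cosp k)); last by move=> k'; left.
  exact: affine_relation_phase gen az.
have wpq : w q = w p.
  move: aw; under eq_bigr => k _ do rewrite aE intrB mulrBl.
  rewrite sumrB (bigD1 p)//= [X in _ - X](bigD1 q)//= !eqxx !mul1r.
  rewrite !big1 ?addr0; first by move/eqP; rewrite subr_eq0 => /eqP.
    by move=> k /negbTE ->; rewrite mul0r.
  by move=> k /negbTE ->; rewrite mul0r.
(* The terms p and q go onto the imaginary axis, all others onto the positive
   real axis. *)
pose th k := if (k == p) || (k == q) then 1 / 4 - alpha p else - alpha k.
have thp : th p = 1 / 4 - alpha p by rewrite /th eqxx.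
have thq : th q = 1 / 4 - alpha p by rewrite /th eqxx orbT.
have others k : k != p -> k != q -> c k = 0.
  move=> kp kq.
  have cosk k' : k' != p -> k' != q -> 0 < cos (2 * pi * (alpha k' + th k')).
    by move=> /negbTE k'p /negbTE k'q; rewrite /th k'p k'q subrr mulr0 cos0.
  apply: (@phase_selection R N.+1 f tau w alpha th c p
    f_pos rel polarc _ _ k (cosk k kp kq)).
  - apply: (affine_relation_phase (z := 0) gen).
    under eq_bigr => k' _ do rewrite aE intrB mulrBl.
    rewrite sumrB (bigD1 p)//= [X in _ - X](bigD1 q)//= !eqxx !mul1r.
    rewrite !big1 ?addr0 ?thp ?thq ?subrr// => k' /negbTE ->; exact: mul0r.
  - move=> k'; have [->|k'p] := eqVneq k' p.
      right; split=> //; apply: (@cos_quarter_int _ 0); left.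
      by rewrite thp; ring.
    have [->|k'q] := eqVneq k' q; last by left; exact: cosk.
    right; split=> //; apply: (@cos_quarter_int _ (- z)); right.
    rewrite thp mulrNz; lra.
have rel2 : {ae @lebesgue_measure R, forall t,
    c p * f (t - tau p) + c q * f (t - tau q) = 0}.
  have aeF := ae_lebesgue_filter R.
  move: rel; apply: filterS => t /= h.
  rewrite -[RHS](mulr0 (cexp (- (w p * t)))) -[in RHS]h.
  rewrite [in RHS](bigD1 p)//= [in RHS](bigD1 q) 1?eq_sym//= big1; last first.
    by move=> k /andP[kp kq]; rewrite others// mul0r.
  rewrite wpq addr0 -[LHS]mul1r -(cexpNM (w p * t)); ring.
have tpq : tau p != tau q.
  apply: contra pq => /eqP tpq; apply/eqP/Lambda_inj.
  by rewrite [Lambda p]surjective_pairing [Lambda q]surjective_pairing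
     -/(tau p) -/(tau q) -/(w p) -/(w q) tpq wpq.
have cp : c p = 0 by exact: two_term_relation f_L2 f_pos tpq rel2.
have cq : c q = 0.
  apply: (two_term_relation f_L2 f_pos (t1 := tau q) (t2 := tau p) (c2 := c p)).
    by rewrite eq_sym.
  have aeF := ae_lebesgue_filter R.
  by move: rel2; apply: filterS => t /= <-; rewrite addrC.
move=> k; have [->//|kp] := eqVneq k p.
by have [->//|kq] := eqVneq k q; exact: others.
Qed.
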